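(* Let $p\ge 7$ be a prime and let $\mathbb{H}=(\mathbb{Z}/p\mathbb{Z})/G$ be the quotient hyperfield with $G\subseteq(\mathbb{Z}/p\mathbb{Z})^\times$ a subgroup with $|G|=3$. Then there exist positive integer solutions $(a,b)$ to $a^2-ab+b^2=p$; the sum $a+b$ takes exactly two values $m,n$ as $(a,b)$ ranges over these solutions, and $\operatorname{gen}(\mathbb{H})=\{3,m,n\}$.
   Context: Let $p$ be a prime and $G$ a subgroup of $(\mathbb{Z}/p\mathbb{Z})^\times$. The hyperfield $\mathbb{H}=(\mathbb{Z}/p\mathbb{Z})/G$ has as elements the orbits $[a]=\{ga: g\in G\}$, $a\in\mathbb{Z}/p\mathbb{Z}$; multiplication is $[a]\odot[b]=[ab]$, and the multivalued hyperaddition is $[a]\boxplus[b]=\{[c] : [c]\subseteq\{x+y : x\in[a],\ y\in[b]\}\}$, extended to non-empty subsets $A,B$ of $\mathbb{H}$ by $A\boxplus B=\bigcup_{\alpha\in A,\beta\in B}(\alpha\boxplus\beta)$. The zero element is $0=[0]$. For a natural number $k$ and $x\in\mathbb{H}$, $kx$ denotes the set $x\boxplus x\boxplus\cdots\boxplus x$ with $k$ copies of $x$ (the empty sum being $\{0\}$). The characteristic $\operatorname{char}(\mathbb{H})$ is the additive submonoid (containing $0$) of all natural numbers $k$ such that $0\in kx$ for all $x\in\mathbb{H}$. The generating set $\operatorname{gen}(\mathbb{H})$ is the finite set $\{g_1,\dots,g_r\}$ of distinct natural numbers of minimal cardinality such that $\operatorname{char}(\mathbb{H})=\{g_1x_1+\cdots+g_rx_r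 : x_i\in\mathbb{Z}_{\ge0}\}$. *)

(* Defs.v *)
From HB Require Import structures.
From mathcomp Require Import all_boot all_order all_algebra all_fingroup.
From mathcomp Require Import finmap.

Set Implicit Arguments.
Unset Strict Implicit.
Unset Printing Implicit Defensive.

Import GRing.Theory.
Local Open Scope ring_scope.
Local Open Scope group_scope.

Section QuotientHyperfield.

Variables (p : nat) (G : {group {unit 'F_p}}).

Definition hclass_set (a : 'F_p) : {set 'F_p} := orbit 'U%act G a.

(* 'F_p is the field Z/pZ only when p is prime, which is assumed in every use. *)
Definition hyperfield : finType :=
  {A : {set 'F_p} | A \in hclass_set @: [set: 'F_p]}.

Definition hclass (a : 'F_p) : hyperfield :=
  exist _ (hclass_set a) (imset_f hclass_set (in_setT a)).

Definition hzero : hyperfield := hclass 0%R.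

Definition hadd (x y : hyperfield) : {set hyperfield} :=
  [set z : hyperfield |
    val z \subset [set (a + b)%R | a in val x, b in val y]].

Definition hadd_set (X Y : {set hyperfield}) : {set hyperfield} :=
  \bigcup_(x in X) \bigcup_(y in Y) hadd x y.

(* [iterop] gives {0} for k = 0, {x} for k = 1, and otherwise the sum of
   exactly k copies of {x}. *)
Definition hmuln (k : nat) (x : hyperfield) : {set hyperfield} :=
  iterop k hadd_set [set x] [set hzero].

Definition hchar : {pred nat} :=
  [pred k | [forall x : hyperfield, hzero \in hmuln k x]].

End QuotientHyperfield.

Definition generates (S : {fset nat}) (M : {pred nat}) : Prop :=
  forall k : nat,
    k \in M <-> exists c : nat -> nat, k = (\sum_(g <- S) g * c g)%N.

Definition minimal_generating_set (S : {fset nat}) (M : {pred nat}) : Prop :=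
  generates S M /\
  forall T : {fset nat}, generates T M -> (#|` S| <= #|` T|)%N.

(* The functional notation gen(H) presupposes that a generating set of minimal
   cardinality is unique, so gen(H) = S asserts that S is the only one. *)
Definition hgen_eq (p : nat) (G : {group {unit 'F_p}}) (S : {fset nat}) : Prop :=
  forall T : {fset nat}, minimal_generating_set T (hchar G) <-> T = S.

Definition norm_solution (p a b : nat) : Prop :=
  [/\ (0 < a)%N, (0 < b)%N &
      (a%:Z ^+ 2 - a%:Z * b%:Z + b%:Z ^+ 2 = p%:Z)%R].

(* Main.v *)
(** If [w] generates [G], then [k] lies in the characteristic iff [k = i + j + l]
    with [i + j w + l w^2 = 0] in [F_p], so that [p] divides the Eisenstein norm
    [N = i^2 + j^2 + l^2 - ij - jl - il], where [N <= k^2] and [N = k^2 mod 3].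
    Suppose [3] does not divide [k] and write [N = c p]; as [p = 1 mod 3], also
    [c = 1 mod 3].  If [c = 1], subtracting the least of [i, j, l] from all three
    leaves a solution of [a^2 - ab + b^2 = p], so [k] is [m] or [n] plus a multiple
    of [3].  Otherwise [c >= 4], so [k >= 2 sqrt p >= m, n]; since [m] and [n]
    represent the two nonzero classes mod [3], [k] exceeds one of them by a
    multiple of [3].  Solutions exist by Thue's lemma; [3], [m] and [n] are
    irreducible in the characteristic, hence belong to every generating set. *)

Require Import Defs.
From mathcomp Require Import all_boot all_order all_algebra all_fingroup all_solvable.
From mathcomp Require Import finmap zify ring.
Set Implicit Arguments.
Unset Strict Implicit.
Unset Printing Implicit Defensive.
Import GRing.Theory Num.Theory Order.TTheory.
Local Open Scope ring_scope.

(** * Representations of [p] by the form [a^2 - ab + b^2] *)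

(* In Eisenstein integers, [a + b w] and [c + d w] of norm [P] with [P] dividing
   the imaginary part of one times the conjugate of the other differ by a unit;
   [4 P^2 = I^2 + 3 (ad - bc)^2] with [I] the inner product leaves six cases. *)
Lemma eis_form_aligned (P a b c d : int) :
    0 < a -> 0 < b -> 0 < c -> 0 < d -> 0 < P ->
    a ^+ 2 - a * b + b ^+ 2 = P -> c ^+ 2 - c * d + d ^+ 2 = P ->
    (P %| a * d - b * c)%Z ->
  [\/ c = a /\ d = b, c = a - b /\ d = a | c = b /\ d = b - a].
Proof.
move=> a0 b0 c0 d0 P0 Nab Ncd /dvdzP[q Eq].
pose I := 2 * a * c - a * d - b * c + 2 * b * d.
have E4 : I ^+ 2 + 3 * (a * d - b * c) ^+ 2 = 4 * P ^+ 2.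
  rewrite -[P ^+ 2]/(P * P) -{1}Nab -Ncd /I; ring.
(* [I] and [a * d - b * c] are linear in [(c, d)] with determinant [2 * P]; this solves for [c] and
   [d]. *)
have cE : 2 * P * c = a * I - (2 * b - a) * (q * P).
  by rewrite -Eq -Nab /I; ring.
have dE : 2 * P * d = b * I + (2 * a - b) * (q * P).
  by rewrite -Eq -Nab /I; ring.
have Pn0 : P != 0 by lia.
have {}E4 : I ^+ 2 = (4 - 3 * q ^+ 2) * P ^+ 2.
  by rewrite mulrBl -E4 Eq; ring.
have q1 : -1 <= q <= 1.
  have : 0 <= 4 - 3 * q ^+ 2 by rewrite -(pmulr_lge0 _ (exprn_gt0 2 P0)) -E4 sqr_ge0.
  by clear; nia.
have [t It Et] : exists2 t, I = t * P & t ^+ 2 = 4 - 3 * q ^+ 2.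
  have [s sE] : exists s : int, s ^+ 2 = 4 - 3 * q ^+ 2.
    have [->|[->|->]] : q = -1 \/ q = 0 \/ q = 1 by move: q1; clear; lia.
    - by exists 1.
    - by exists 2.
    - by exists 1.
  move: E4; rewrite -sE -exprMn => /eqP; rewrite eqf_sqr => /orP[]/eqP ->.
  - by exists s.
  - by exists (- s); rewrite ?mulNr ?sqrrN.
have {cE}cE : 2 * c = a * t - (2 * b - a) * q.
  apply: (mulfI Pn0); transitivity (2 * P * c); first ring.
  by rewrite cE It; ring.
have {dE}dE : 2 * d = b * t + (2 * a - b) * q.
  apply: (mulfI Pn0); transitivity (2 * P * d); first ring.
  by rewrite dE It; ring.
have tq : (t = 2 \/ t = -2) /\ q = 0 \/ (t = 1 \/ t = -1) /\ (q = 1 \/ q = -1).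
  have [qE|[qE|qE]] : q = -1 \/ q = 0 \/ q = 1 by move: q1; clear; lia.
  - by move: Et; rewrite qE; clear; nia.
  - by move: Et; rewrite qE; clear; nia.
  - by move: Et; rewrite qE; clear; nia.
(* The six units come in pairs of opposite sign; positivity of [c] and [d] leaves one of each
   pair. *)
have [[[tE|tE] qE]|[[tE|tE] [qE|qE]]] := tq; move: cE dE a0 b0 c0 d0;
  rewrite tE qE; clear;
  do ?[by constructor 1; lia | by constructor 2; lia | by constructor 3; lia | lia].
Qed.

Lemma prime_neq_sqr (n p : nat) : prime p -> (n ^ 2)%N <> p.
Proof.
move=> p_pr /(congr1 (logn p)); rewrite lognX (logn_prime p p_pr) eqxx /=.
by clear; lia.
Qed.

(** Among aligned solutions only [(a, b)] and [(a - b, a)] survive [b < a], as the third has the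
    negative entry [b - a]; conjugation swaps the entries and keeps the sum. *)
Lemma norm_solution_sum (p a b c d : nat) :
    prime p -> (b < a)%N -> norm_solution p a b -> norm_solution p c d ->
  (c + d = a + b)%N \/ (c + d = 2 * a - b)%N.
Proof.
move=> p_pr ltba [a0 b0 Nab] [c0 d0 Ncd].
have p0 := prime_gt0 p_pr.
(* [(ad - bc)(ac - bd) = p (cd - ab)]; the second factor is the first one for the
   conjugate solution [(d, c)]. *)
have : (p%:Z %| (a%:Z * d%:Z - b%:Z * c%:Z) * (a%:Z * c%:Z - b%:Z * d%:Z))%Z.
  apply/dvdzP; exists (c%:Z * d%:Z - a%:Z * b%:Z).
  by rewrite [RHS]mulrBl -{1}Nab -Ncd; ring.
rewrite !dvdzE abszM Euclid_dvdM // -!dvdzE => /orP[] dvd.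
- have [|||||[cE dE]|[cE dE]|[cE dE]] := eis_form_aligned _ _ _ _ _ Nab Ncd dvd => //.
  + by left; move: cE dE; clear; lia.
  + by right; move: cE dE ltba; clear; lia.
  + by move: cE dE ltba d0; clear; lia.
- have Ndc : d%:Z ^+ 2 - d%:Z * c%:Z + c%:Z ^+ 2 = p%:Z by rewrite -Ncd; ring.
  have [|||||[cE dE]|[cE dE]|[cE dE]] := eis_form_aligned _ _ _ _ _ Nab Ndc dvd => //.
  + by left; move: cE dE; clear; lia.
  + by right; move: cE dE ltba; clear; lia.
  + by move: cE dE ltba c0; clear; lia.
Qed.

(** * Triples whose Eisenstein norm is a multiple of [p] *)

(** The norm is invariant under a common shift, so subtracting [l] leaves the two-variable form; a
    zero entry there would make [p] a square. *)
Lemma norm_solution_three (p a b i j l : nat) :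
    prime p -> (b < a)%N -> norm_solution p a b -> (l <= i)%N -> (l <= j)%N ->
    i%:Z ^+ 2 + j%:Z ^+ 2 + l%:Z ^+ 2 - i%:Z * j%:Z - j%:Z * l%:Z - i%:Z * l%:Z
      = p%:Z ->
  (i + j + l = 3 * l + (a + b) \/ i + j + l = 3 * l + (2 * a - b))%N.
Proof.
move=> p_pr ltba sol /subnK <- /subnK <-.
move: (i - l)%N (j - l)%N => {i j} i j Nijl.
have Nij : i%:Z ^+ 2 - i%:Z * j%:Z + j%:Z ^+ 2 = p%:Z.
  by rewrite -Nijl !PoszD; ring.
have not_sqr (n : nat) : n%:Z ^+ 2 <> p%:Z.
  by move=> nE; apply: (@prime_neq_sqr n p p_pr); move: nE; clear; lia.
have i0 : (0 < i)%N.
  by case: i Nij {Nijl} => // Nij; case: (not_sqr j); rewrite -Nij; ring.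
have j0 : (0 < j)%N.
  by case: j Nij {Nijl} => // Nij; case: (not_sqr i); rewrite -Nij; ring.
have sol' : norm_solution p i j by split.
have [] := norm_solution_sum p_pr ltba sol sol'; [left|right]; lia.
Qed.

(** From [p = (a + b)^2 - 3ab], a factor [3] of the sum would divide [p]. *)
Lemma norm_solution_sum_mod3 (p a b : nat) :
  prime p -> (3 < p)%N -> norm_solution p a b -> ~~ (3 %| a + b)%N.
Proof.
move=> p_pr p3 [a0 b0 Nab]; apply/negP => /dvdnP[q qE].
have : (3 %| p%:Z)%Z.
  apply/dvdzP; exists (3 * q%:Z ^+ 2 - a%:Z * b%:Z).
  have -> : p%:Z = (a + b)%:Z ^+ 2 - 3 * (a%:Z * b%:Z) by rewrite -Nab PoszD; ring.
  by rewrite qE PoszM; ring.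
by rewrite dvdzE /= dvdn_prime2 // => /eqP p3'; rewrite -p3' in p3.
Qed.

Lemma dvd_norm_three_generators (p a b i j l : nat) :
    prime p -> (3 < p)%N -> (b < a)%N -> norm_solution p a b ->
    (p%:Z %| i%:Z ^+ 2 + j%:Z ^+ 2 + l%:Z ^+ 2
             - i%:Z * j%:Z - j%:Z * l%:Z - i%:Z * l%:Z)%Z ->
  exists x y z, (i + j + l = 3 * x + (a + b) * y + (2 * a - b) * z)%N.
Proof.
move=> p_pr p3 ltba sol; have [a0 b0 Nab] := sol.
case/dvdzP => c cE.
have [k3|k3] := boolP (3 %| i + j + l)%N.
  by exists ((i + j + l) %/ 3)%N, 0%N, 0%N; rewrite !muln0 !addn0 mulnC divnK.
have {Nab}pE : p%:Z = (a + b)%:Z ^+ 2 - 3 * (a%:Z * b%:Z) by rewrite -Nab PoszD; ring.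
have m3 := norm_solution_sum_mod3 p_pr p3 sol.
have kE : c * p%:Z = (i + j + l)%:Z ^+ 2 - 3 * (i%:Z * j%:Z + j%:Z * l%:Z + i%:Z * l%:Z).
  by rewrite -cE !PoszD; ring.
(* Neither [i + j + l] nor [a + b] is divisible by [3], so their squares are [1] mod [3]; hence so
   are [c * p] and [p]. *)
have c13 : (c = 1 %[mod 3])%Z.
  move: kE pE k3 m3; set k := (i + j + l)%N; set m := (a + b)%N; clear.
  set e := (_ + _ + _); set f := (a%:Z * b%:Z) => kE pE k3 m3.
  have [k' [r [kE' r12]]] : exists k' r : int, k%:Z = 3 * k' + r /\ (r = 1 \/ r = 2).
    by exists (k %/ 3)%N, (k %% 3)%N; lia.
  have [m' [s [mE' s12]]] : exists k' r : int, m%:Z = 3 * k' + r /\ (r = 1 \/ r = 2).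
    by exists (m %/ 3)%N, (m %% 3)%N; lia.
  have [p' p'E] : exists p', p%:Z = 3 * p' + 1.
    rewrite pE mE'; case: s12 => ->.
    - by exists (3 * m' ^+ 2 + 2 * m' - f); ring.
    - by exists (3 * m' ^+ 2 + 4 * m' + 1 - f); ring.
  have [k'' k''E] : exists k'', c * p%:Z = 3 * k'' + 1.
    rewrite kE kE'; case: r12 => ->.
    - by exists (3 * k' ^+ 2 + 2 * k' - e); ring.
    - by exists (3 * k' ^+ 2 + 4 * k' + 1 - e); ring.
  have : c = 3 * (k'' - c * p') + 1.
    by rewrite mulrBr -addrA [_ + 1]addrC addrA -k''E p'E; ring.
  by clear; lia.
have c0 : 0 <= c.
  have p0 : 0 < p%:Z by rewrite ltz_nat prime_gt0.
  have : 0 <= 2 * (c * p%:Z).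
    rewrite -cE [X in 0 <= X](_ : _ = (i%:Z - j%:Z) ^+ 2 + (j%:Z - l%:Z) ^+ 2 +
      (i%:Z - l%:Z) ^+ 2); last by ring.
    by rewrite !addr_ge0 ?sqr_ge0.
  by rewrite pmulr_rge0 // pmulr_lge0.
have [c1|c4] : c = 1 \/ 4 <= c by move: c13 c0; clear; lia.
  have {cE} := cE; rewrite c1 mul1r => {c1 kE c13 c0} NE.
  (* The norm is symmetric, so whichever entry is least can play the role of [l]. *)
  have : (l <= i /\ l <= j \/ i <= j /\ i <= l \/ j <= i /\ j <= l)%N by lia.
  case=> [[li lj]|[[ij il]|[ji jl]]].
  - have [] := norm_solution_three p_pr ltba sol li lj NE => ->.
    + by exists l, 1%N, 0%N; rewrite muln1 muln0 addn0.
    + by exists l, 0%N, 1%N; rewrite muln1 muln0 addn0.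
  - rewrite -addnA addnC.
    have [||] := norm_solution_three p_pr ltba sol ij il => [|->|->].
    + by rewrite -NE; ring.
    + by exists i, 1%N, 0%N; rewrite muln1 muln0 addn0.
    + by exists i, 0%N, 1%N; rewrite muln1 muln0 addn0.
  - rewrite addnAC.
    have [||] := norm_solution_three p_pr ltba sol ji jl => [|->|->].
    + by rewrite -NE; ring.
    + by exists j, 1%N, 0%N; rewrite muln1 muln0 addn0.
    + by exists j, 0%N, 1%N; rewrite muln1 muln0 addn0.
have sqr_k : 4 * p%:Z <= (i + j + l)%:Z ^+ 2.
  have : 4 * p%:Z <= c * p%:Z by rewrite ler_wpM2r.
  by rewrite kE; clear; nia.
(* The gap is [4p - (a + b)^2 = 3(a - b)^2]; for [nk] below it is [4p - (2a - b)^2 = 3b^2]. *)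
have mk : (a + b <= i + j + l)%N.
  move: sqr_k; rewrite pE; clear.
  have : 0 <= 3 * (a%:Z - b%:Z) ^+ 2 by rewrite mulr_ge0 ?sqr_ge0.
  by move: (i + j + l)%N => k; nia.
have nk : (2 * a - b <= i + j + l)%N.
  move: sqr_k ltba; rewrite pE; clear.
  move: (i + j + l)%N => k sqr_k ltba.
  have : ((2 * a - b)%N%:Z = 2 * a%:Z - b%:Z) by lia.
  move: (2 * a - b)%N => n nE.
  have : n%:Z ^+ 2 <= k%:Z ^+ 2.
    apply: le_trans sqr_k.
    rewrite nE -subr_ge0 [X in 0 <= X](_ : _ = 3 * b%:Z ^+ 2) ?mulr_ge0 ?sqr_ge0 //.
    by rewrite PoszD; ring.
  by clear; nia.
(* The two sums add up to [3a] and are prime to [3], so they cover both nonzero classes. *)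
have [kmod|kmod] : ((i + j + l) %% 3 = (a + b) %% 3 \/
                    (i + j + l) %% 3 = (2 * a - b) %% 3)%N.
  by move: k3 m3 ltba; move: (i + j + l)%N => k; clear; lia.
- exists ((i + j + l - (a + b)) %/ 3)%N, 1%N, 0%N.
  by move: kmod mk; clear; lia.
- exists ((i + j + l - (2 * a - b)) %/ 3)%N, 0%N, 1%N.
  by move: kmod nk; clear; lia.
Qed.

(** * Existence of a solution by Thue's pigeonhole argument *)

Lemma ord_sub_sqr (r : nat) (x y : 'I_r.+1) : (x%:Z - y%:Z) ^+ 2 <= (r ^ 2)%N%:Z.
Proof.
have := ltn_ord x; have := ltn_ord y; move: (nat_of_ord x) (nat_of_ord y).
clear => x y yr xr; rewrite -subr_ge0.
rewrite [X in 0 <= X](_ : _ = (r%:Z - (x%:Z - y%:Z)) * (r%:Z + (x%:Z - y%:Z))).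
  by rewrite mulr_ge0 //; lia.
by rewrite -mulnn PoszM; ring.
Qed.

Lemma norm_solution_exists (p : nat) (w : 'F_p) :
  prime p -> (2 < p)%N -> w ^+ 2 + w + 1 = 0 -> exists a b, norm_solution p a b.
Proof.
move=> p_pr p2 w3.
have [r rE] : exists r, (r ^ 2 <= p < r.+1 ^ 2)%N.
  have ex : exists n, (n ^ 2 <= p)%N by exists 0%N.
  have bnd n : (n ^ 2 <= p)%N -> (n <= p)%N by apply: leq_trans; clear; nia.
  case: (ex_maxnP ex bnd) => r rp rmax; exists r; rewrite rp ltnNge /=.
  by apply/negP => /rmax; rewrite ltnn.
have [rp pr] := andP rE.
(* Strictness makes the square of any difference of two numbers in [[0, r]] less than [p]. *)
have rltp : (r ^ 2 < p)%N.
  by rewrite ltn_neqAle rp andbT; apply/eqP => /prime_neq_sqr; apply.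
(* There are [(r + 1)^2 > p] pairs, so two collide under [f]; their differences satisfy
   [u = w v]. *)
pose f (xy : 'I_r.+1 * 'I_r.+1) : 'F_p := xy.1%:R - w * xy.2%:R.
have : ~~ injectiveb f.
  apply/injectiveP => /leq_card.
  by rewrite card_prod card_ord card_Fp // leqNgt mulnn pr.
case/injectivePn => -[x1 y1] [[x2 y2]] neq fE.
pose u : int := x1%:Z - x2%:Z; pose v : int := y1%:Z - y2%:Z.
have uv : u%:~R = w * v%:~R :> 'F_p.
  rewrite /u /v !intrD !mulrNz mulrBr -!pmulrn.
  apply/eqP; rewrite -subr_eq0 [X in X == _](_ : _ = f (x1, y1) - f (x2, y2)).
    by rewrite fE subrr.
  by rewrite /f /=; ring.
have uv0 : ~ (u = 0 /\ v = 0).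
  case=> /eqP; rewrite subr_eq0 => /eqP[] /val_inj xE /eqP.
  rewrite subr_eq0 => /eqP[] /val_inj yE.
  by rewrite xE yE eqxx in neq.
have bu : u ^+ 2 < p%:Z by apply: le_lt_trans (ord_sub_sqr _ _) _.
have bv : v ^+ 2 < p%:Z by apply: le_lt_trans (ord_sub_sqr _ _) _.
have : (p%:Z %| u ^+ 2 + u * v + v ^+ 2)%Z.
  rewrite (dvdz_pcharf (pchar_Fp p_pr)) !intrD !rmorphM /= uv.
  by apply/eqP; transitivity (v%:~R ^+ 2 * (w ^+ 2 + w + 1)); [ring|rewrite w3 mulr0].
case/dvdzP => c cE.
move: u v {uv} uv0 bu bv cE => {rE rp pr rltp f neq fE x1 x2 y1 y2} u v uv0 bu bv cE.
(* The form is positive definite, and each of its three terms is below [p]. *)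
have c12 : c = 1 \/ c = 2.
  have c0 : 0 < c * p%:Z by move: uv0; rewrite -cE; clear; nia.
  have c3 : c * p%:Z < 3 * p%:Z by move: bu bv; rewrite -cE; clear; nia.
  by move: c0 c3; clear; nia.
case: c12 cE => ->; last first.
  (* An even value of [u^2 + uv + v^2] forces [u] and [v] even, so [4] would divide [2p] with [p]
     odd. *)
  move=> E; exfalso.
  have [u' [v' [uE vE]]] : exists u' v', u = 2 * u' /\ v = 2 * v'.
    have uE := divz_eq u 2; have vE := divz_eq v 2.
    exists (u %/ 2)%Z, (v %/ 2)%Z.
    have [rE [sE|sE]] : (u %% 2 = 0 \/ u %% 2 = 1)%Z /\ (v %% 2 = 0 \/ v %% 2 = 1)%Z by lia.
    - case: rE => rE; first by lia.
      move: E; rewrite uE vE rE sE; clear; nia.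
    - move: E; rewrite uE vE sE; case: rE => ->; clear; nia.
  have pE : p%:Z = 2 * (u' ^+ 2 + u' * v' + v' ^+ 2).
    by apply: (@mulfI _ (2 : int)) => //; rewrite -E uE vE; ring.
  have : (2 %| p%:Z)%Z by rewrite pE dvdz_mulr.
  by rewrite dvdzE /= dvdn_prime2 // => /eqP p2'; rewrite -p2' in p2.
rewrite mul1r => E.
have n0 x : x ^+ 2 <> p%:Z.
  move=> xE; apply: (@prime_neq_sqr `|x|%N p p_pr).
  by move: xE; clear; lia.
have abs_sqr (x : int) : `|x|%N%:Z ^+ 2 = x ^+ 2 by rewrite abszE real_normK ?num_real.
have u0 : u != 0 by apply/eqP => u0; apply: (n0 v); rewrite -E u0; ring.
have v0 : v != 0 by apply/eqP => v0; apply: (n0 u); rewrite -E v0; ring.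
(* The sign of the middle term must be reversed: absolute values do it if [uv <= 0]; otherwise
   substituting [u + v] for [u] does. *)
have [s|s] := lerP (u * v) 0.
- exists `|u|%N, `|v|%N; split; rewrite ?absz_gt0 //.
  by rewrite !abs_sqr -PoszM -abszM abszE ler0_norm // opprK -E.
- have uvv : 0 <= (u + v) * v by rewrite mulrDl addr_ge0 -?expr2 ?sqr_ge0 // ltW.
  exists `|(u + v)%R|%N, `|v|%N; split; rewrite ?absz_gt0 //.
    by move: s; clear; nia.
  by rewrite !abs_sqr -PoszM -abszM abszE ger0_norm // -E; ring.
Qed.

(** * Multiples of a class in the quotient by the cube roots of unity *)

Section CubicClasses.

Variables (p : nat) (G : {group {unit 'F_p}}).

Lemma mem_hclass_set (a c : 'F_p) :
  reflect (exists2 u, u \in G & c = a * \val u) (c \in hclass_set G a).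
Proof.
apply: (iffP orbitP) => [[u uG <-]|[u uG ->]]; exists u => //.
Qed.

Lemma hclassP (x : hyperfield G) : exists a, x = hclass G a.
Proof.
case: x => A AG; have /imsetP[a _ aE] := AG.
by exists a; apply: val_inj.
Qed.

Lemma hclass_eq (a c : 'F_p) :
  hclass G c = hclass G a <-> exists2 u, u \in G & c = a * \val u.
Proof.
split=> [/(congr1 val) /= ca|/mem_hclass_set ca].
  by apply/mem_hclass_set; rewrite -ca; apply/mem_hclass_set; exists 1%g;
    rewrite ?group1 //= mulr1.
by apply: val_inj; apply/orbit_eqP.
Qed.

(** The sumset of two orbits is stable under [G], so it contains an orbit as soon as it contains one
    representative. *)
Lemma mem_hadd (a b c : 'F_p) :
  hclass G c \in hadd (hclass G a) (hclass G b) <->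
  exists u v, [/\ u \in G, v \in G & c = a * \val u + b * \val v].
Proof.
rewrite inE; split=> [/subsetP/(_ c)|[u [v [uG vG cE]]]].
  case/(_ _)/imset2P.
    by apply/mem_hclass_set; exists 1%g; rewrite ?group1 //= mulr1.
  move=> _ _ /mem_hclass_set[u uG ->] /mem_hclass_set[v vG ->] ->.
  by exists u, v.
apply/subsetP => _ /mem_hclass_set[t tG ->]; apply/imset2P.
exists (a * \val (u * t)%g) (b * \val (v * t)%g).
- by apply/mem_hclass_set; exists (u * t)%g; rewrite ?groupM.
- by apply/mem_hclass_set; exists (v * t)%g; rewrite ?groupM.
by rewrite cE !FinRing.val_unitM mulrDl !mulrA.
Qed.

(** The recursion starts at [k.+2] because [iterop] returns singletons at [0] and [1]. *)
Lemma hmulnS (a c : 'F_p) (k : nat) :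
  hclass G c \in hmuln k.+2 (hclass G a) <->
  exists b u v, [/\ hclass G b \in hmuln k.+1 (hclass G a), u \in G, v \in G
                & c = a * \val u + b * \val v].
Proof.
rewrite [hmuln k.+2 _]/(hadd_set _ _); split.
  case/bigcupP => _ /set1P -> /bigcupP[y]; have [b ->] := hclassP y.
  by move=> yk /mem_hadd[u [v [uG vG cE]]]; exists b, u, v.
move=> [b [u [v [bk uG vG cE]]]]; apply/bigcupP; exists (hclass G a).
  exact: set11.
by apply/bigcupP; exists (hclass G b) => //; apply/mem_hadd; exists u, v.
Qed.

Variable w : 'F_p.
Hypotheses (w3 : w ^+ 2 + w + 1 = 0)
  (Gw : forall c, (exists2 u, u \in G & c = \val u) <-> [\/ c = 1, c = w | c = w ^+ 2]).

(** Sums of [k] elements of [G = {1, w, w^2}], recorded by the multiplicity of each element. *)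
Definition w_sum (k : nat) (s : 'F_p) : Prop :=
  exists i j l : nat, k = (i + j + l)%N /\ s = i%:R + j%:R * w + l%:R * w ^+ 2.

Lemma w_cube : w ^+ 3 = 1.
Proof.
apply/eqP; rewrite -subr_eq0 (_ : _ - 1 = (w - 1) * (w ^+ 2 + w + 1)); last by ring.
by rewrite w3 mulr0.
Qed.

(** Multiplication by a power of [w] permutes the three multiplicities cyclically. *)
Lemma w_sum_mulG k s u : u \in G -> w_sum k s -> w_sum k (s * \val u).
Proof.
move=> uG [i [j [l [-> ->]]]].
have [->|->|->] := (Gw (\val u)).1 (ex_intro2 _ _ u uG erefl).
- by exists i, j, l; rewrite mulr1.
- exists l, i, j; split; first by lia.
  rewrite [LHS](_ : _ = i%:R * w + j%:R * w ^+ 2 + l%:R * w ^+ 3); last by ring.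
  by rewrite w_cube; ring.
- exists j, l, i; split; first by lia.
  rewrite [LHS](_ : _ = i%:R * w ^+ 2 + j%:R * w ^+ 3 + l%:R * (w ^+ 3 * w)); last by ring.
  by rewrite w_cube; ring.
Qed.

Lemma w_sumS k s :
  w_sum k.+1 s <-> exists u t, [/\ u \in G, w_sum k t & s = \val u + t].
Proof.
split=> [[i [j [l [kE ->]]]]|[u [t [uG [i [j [l [-> ->]]]] ->]]]].
  have [[i' iE]|[[j' jE]|[l' lE]]] :
      (exists i', i = i'.+1) \/ (exists j', j = j'.+1) \/ (exists l', l = l'.+1).
    case: i kE => [|i _]; last by left; exists i.
    case: j => [|j _]; last by right; left; exists j.
    by case: l => // l _; right; right; exists l.
  - have [u uG uE] : exists2 u, u \in G & 1 = \val u by apply/Gw; constructor 1.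
    exists u, (i'%:R + j%:R * w + l%:R * w ^+ 2); split=> //.
      by exists i', j, l; split=> //; move: kE; rewrite iE => -[].
    by rewrite -uE iE -natr1; ring.
  - have [u uG uE] : exists2 u, u \in G & w = \val u by apply/Gw; constructor 2.
    exists u, (i%:R + j'%:R * w + l%:R * w ^+ 2); split=> //.
      by exists i, j', l; split=> //; move: kE; rewrite jE; clear; lia.
    by rewrite -uE jE -natr1; ring.
  - have [u uG uE] : exists2 u, u \in G & w ^+ 2 = \val u by apply/Gw; constructor 3.
    exists u, (i%:R + j%:R * w + l'%:R * w ^+ 2); split=> //.
      by exists i, j, l'; split=> //; move: kE; rewrite lE; clear; lia.
    by rewrite -uE lE -natr1; ring.
have [->|->|->] := (Gw (\val u)).1 (ex_intro2 _ _ u uG erefl).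
- by exists i.+1, j, l; split=> //; rewrite -natr1; ring.
- by exists i, j.+1, l; split; [lia | rewrite -natr1; ring].
- by exists i, j, l.+1; split; [lia | rewrite -natr1; ring].
Qed.

(** Each hyperaddition also multiplies the partial sum by some [v] in [G]; [w_sum_mulG] absorbs that
    factor. *)
Lemma mem_hmuln (a c : 'F_p) (k : nat) :
  hclass G c \in hmuln k (hclass G a) <-> exists2 s, w_sum k s & c = a * s.
Proof.
elim: k c => [|[|k] IHk] c.
- rewrite inE; split=> [/eqP/hclass_eq[u _ ->]|[_ [i [j [l [kE ->]]]] ->]].
    exists 0; last by rewrite mul0r mulr0.
    by exists 0%N, 0%N, 0%N; split=> //; rewrite !mul0r !addr0.
  have [-> -> ->] : [/\ i = 0, j = 0 & l = 0]%N by split; lia.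
  by rewrite !mul0r !addr0 mulr0.
- rewrite inE; split=> [/eqP/hclass_eq[u uG ->]|[s /w_sumS[u [t [uG tE ->]]] ->]].
    exists (\val u) => //; apply/w_sumS; exists u, 0; split=> //; last by rewrite addr0.
    by exists 0%N, 0%N, 0%N; split=> //; rewrite !mul0r !addr0.
  apply/eqP/hclass_eq; exists u => //; congr (_ * _).
  have [i [j [l [kE ->]]]] := tE.
  have [-> -> ->] : [/\ i = 0, j = 0 & l = 0]%N by split; lia.
  by rewrite !mul0r !addr0.
- split=> [/hmulnS[b [u [v [/IHk[s sk ->] uG vG ->]]]]|[s /w_sumS[u [t [uG tk ->]]] ->]].
    exists (\val u + s * \val v); last by rewrite mulrDr mulrA.
    by apply/w_sumS; exists u, (s * \val v); split=> //; apply: w_sum_mulG.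
  apply/hmulnS; exists (a * t), u, 1%g; split=> //; last by rewrite mulrDr mulr1.
  by apply/IHk; exists t.
Qed.

(** By homogeneity in [a], the class of [1] decides for all classes. *)
Lemma mem_hchar k : k \in hchar G <-> w_sum k 0.
Proof.
split=> [/forallP/(_ (hclass G 1))/mem_hmuln[s sk]|k0].
  by rewrite mul1r => ->.
apply/forallP => x; have [a ->] := hclassP x.
by apply/mem_hmuln; exists 0 => //; rewrite mulr0.
Qed.

End CubicClasses.

(** A generator [g] of [G] serves as [w]: [(g - 1)(g^2 + g + 1) = g^3 - 1 = 0] and [g != 1]. *)
Lemma card3_cube_root (p : nat) (G : {group {unit 'F_p}}) : prime p -> #|G| = 3%N ->
  exists2 w : 'F_p, w ^+ 2 + w + 1 = 0 &
    forall c, (exists2 u, u \in G & c = \val u) <-> [\/ c = 1, c = w | c = w ^+ 2].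
Proof.
move=> p_pr G3; have /cyclicP[g gE] : cyclic G by rewrite prime_cyclic ?G3.
have g3 : #[g]%g = 3%N by rewrite -G3 gE.
have gG : g \in G by rewrite gE cycle_id.
exists (\val g).
  have gn1 : \val g - 1 != 0.
    apply/eqP => /eqP; rewrite subr_eq0 => /eqP g1.
    have {}g1 : g = 1%g by apply: val_inj.
    by rewrite g1 order1 in g3.
  apply: (mulfI gn1); rewrite mulr0.
  transitivity (\val g ^+ 3 - 1); first by ring.
  by rewrite -FinRing.val_unitX -g3 expg_order subrr.
move=> c; split=> [[u]|].
  rewrite gE => /cyclePmin[i]; rewrite g3 => i3 -> ->.
  rewrite FinRing.val_unitX.
  by case: i i3 => [|[|[|i]]] // _; [constructor 1 | constructor 2 | constructor 3].
case=> ->.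
- by exists 1%g.
- by exists g.
- by exists (g ^+ 2)%g; rewrite ?groupX ?FinRing.val_unitX.
Qed.

(** * Vanishing sums of cube roots of unity and the norm form *)

Section WSum.

Variables (p : nat) (w : 'F_p).
Lemma w_sumD k k' s s' : w_sum w k s -> w_sum w k' s' -> w_sum w (k + k') (s + s').
Proof.
move=> [i [j [l [-> ->]]]] [i' [j' [l' [-> ->]]]].
by exists (i + i')%N, (j + j')%N, (l + l')%N; split; [lia | rewrite !natrD; ring].
Qed.

Lemma w_sumMn k n : w_sum w k 0 -> w_sum w (k * n) 0.
Proof.
move=> wk; elim: n => [|n IHn].
  by rewrite muln0; exists 0%N, 0%N, 0%N; split=> //; rewrite !mul0r !addr0.
by rewrite mulnS -[X in w_sum _ _ X]addr0; apply: w_sumD.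
Qed.

Hypotheses (p_pr : prime p) (w3 : w ^+ 2 + w + 1 = 0).

Lemma norm_factor (i j l : 'F_p) :
  i ^+ 2 + j ^+ 2 + l ^+ 2 - i * j - j * l - i * l =
  (i + j * w + l * w ^+ 2) * (i + j * w ^+ 2 + l * w).
Proof.
(* The identity holds modulo [w ^+ 2 + w + 1]; the second summand is the explicit multiple of it. *)
transitivity ((i + j * w + l * w ^+ 2) * (i + j * w ^+ 2 + l * w) + (w ^+ 2 + w + 1) *
  ((j ^+ 2 + l ^+ 2) * (1 - w) - i * j - i * l - j * l * (w ^+ 2 - w + 1))); first by ring.
by rewrite w3 mul0r addr0.
Qed.

Lemma w_sum_norm k : w_sum w k 0 -> exists i j l : nat, k = (i + j + l)%N /\
    (p%:Z %| i%:Z ^+ 2 + j%:Z ^+ 2 + l%:Z ^+ 2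
             - i%:Z * j%:Z - j%:Z * l%:Z - i%:Z * l%:Z)%Z.
Proof.
move=> [i [j [l [-> s0]]]]; exists i, j, l; split=> //.
rewrite (dvdz_pcharf (pchar_Fp p_pr)) !(rmorphB, rmorphD, rmorphM, rmorphXn) /=.
by rewrite -!pmulrn norm_factor -s0 mul0r.
Qed.

(** Over ['F_p] the norm splits into two conjugate factors, one of which vanishes: it adds [a]
    copies of [1] to [b] copies of [w] or of [w ^+ 2]. *)
Lemma norm_solution_w_sum a b : norm_solution p a b -> w_sum w (a + b) 0.
Proof.
move=> [_ _ Nab].
have : (a%:R + b%:R * w) * (a%:R + b%:R * w ^+ 2) = 0 :> 'F_p.
  have := norm_factor a%:R b%:R 0.
  rewrite !(mul0r, mulr0, addr0, subr0, expr0n) /= => <-.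
  have : (p%:Z)%:~R = 0 :> 'F_p by apply/eqP; rewrite -(dvdz_pcharf (pchar_Fp p_pr)) dvdzz.
  rewrite -Nab !(rmorphB, rmorphD, rmorphM, rmorphXn) /= -!pmulrn => <-.
  by ring.
move/eqP; rewrite mulf_eq0 => /orP[] /eqP s0.
- by exists a, b, 0%N; rewrite addn0 mul0r addr0 s0.
- by exists a, 0%N, b; rewrite addn0 mul0r addr0 s0.
Qed.

End WSum.

(** * Irreducible elements and minimal generating sets *)

Lemma generates_irreducible (T : {fset nat}) (M : {pred nat}) (g : nat) :
    generates T M -> g \in M -> (0 < g)%N ->
    (forall u v, u \in M -> v \in M -> (u + v)%N = g -> u = 0%N \/ v = 0%N) ->
  g \in T.
Proof.
move=> genT gM g0 irr.
have M0 : 0%N \in M.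
  by apply/genT; exists (fun=> 0%N); rewrite big1 // => t _; rewrite muln0.
have MD u v : u \in M -> v \in M -> (u + v)%N \in M.
  move=> /genT[c ->] /genT[d ->]; apply/genT; exists (fun t => c t + d t)%N.
  by rewrite -big_split /=; apply: eq_bigr => t _; rewrite mulnDr.
have TM t : t \in T -> t \in M.
  move=> tT; apply/genT; exists (fun x => (x == t) : nat).
  rewrite (bigD1_seq t) ?fset_uniq //= eqxx muln1 big1 ?addn0 // => x /negPf ->.
  by rewrite muln0.
(* [P] holds on [T] and, by irreducibility of [g], passes to sums, so it reaches the expression of
   [g] in the generators. *)
pose P x := x \in M /\ (x = g -> g \in T).
have P0 : P 0%N by split=> // g0'; rewrite -g0' in g0.
have PD u v : P u -> P v -> P (u + v)%N.
  move=> [uM uT] [vM vT]; split; first exact: MD.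
  move=> uvE; case: (irr u v uM vM uvE) => E0; rewrite E0 ?addn0 in uvE.
  - exact: vT.
  - exact: uT.
have PT t : t \in T -> P t by move=> tT; split=> [|<-//]; apply: TM.
have [c gE] := (genT g).1 gM.
suff [_] : P g by apply.
rewrite gE big_seq; apply: (big_ind P) => // t tT.
by elim: (c t) => [|n IHn]; rewrite ?muln0 // mulnS; apply: PD => //; apply: PT.
Qed.

(** Irreducibles lie in every generating set, so [S] is contained in each of them and a minimal one
    cannot be larger. *)
Lemma minimal_generating_set_irreducible (S : {fset nat}) (M : {pred nat}) :
    generates S M ->
    (forall g, g \in S -> [/\ g \in M, (0 < g)%N &
       forall u v, u \in M -> v \in M -> (u + v)%N = g -> u = 0%N \/ v = 0%N]) ->
  forall T, minimal_generating_set T M <-> T = S.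
Proof.
move=> genS irr.
have subT T : generates T M -> fsubset S T.
  move=> genT; apply/fsubsetP => g /irr[gM g0 g_irr].
  exact: generates_irreducible genT gM g0 g_irr.
move=> T; split=> [[genT minT]|->].
  by apply/esym/eqP; rewrite eqEfcard subT //= minT.
by split=> // T' /subT; apply: fsubset_leq_card.
Qed.

(** Distinctness lets three independent coefficients be packed into one function of the
    generator. *)
Lemma generates3 (a b c : nat) (M : {pred nat}) : uniq [:: a; b; c] ->
    (forall k, k \in M <-> exists x y z, k = (a * x + b * y + c * z)%N) ->
  generates [fset a; b; c]%fset M.
Proof.
rewrite /= !inE negb_or andbT => /andP[/andP[ab ac] bc] ME k.
have sumE d : (\sum_(g <- [fset a; b; c]%fset) g * d g = a * d a + b * d b + c * d c)%N.
  rewrite fsetUC !big_fsetU1 ?big_seq_fset1 ?inE //=; first by lia.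
  by rewrite negb_or ![c == _]eq_sym ac.
rewrite ME; split=> [[x [y [z ->]]]|[d ->]]; last first.
  by exists (d a), (d b), (d c); rewrite sumE.
exists (fun g => if g == a then x else if g == b then y else z).
rewrite sumE eqxx [b == a]eq_sym (negPf ab) eqxx [c == a]eq_sym (negPf ac).
by rewrite [c == b]eq_sym (negPf bc).
Qed.

Lemma three_generators_irreducible (m n g u v : nat) (M : {pred nat}) :
    (3 < m)%N -> (3 < n)%N -> ~~ (3 %| m)%N -> ~~ (3 %| n)%N -> (3 %| m + n)%N ->
    (m < 2 * n)%N -> (n < 2 * m)%N ->
    (forall k, k \in M <-> exists x y z, k = (3 * x + m * y + n * z)%N) ->
    g \in [fset 3%N; m; n]%fset -> u \in M -> v \in M -> (u + v)%N = g ->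
  u = 0%N \/ v = 0%N.
Proof.
move=> m3 n3 m_mod n_mod mn_mod mn nm ME gS /ME[x [y [z uE]]] /ME[x' [y' [z' vE]]] uvE.
have {gS} gS : [\/ g = 3%N, g = m | g = n].
  by move: gS; rewrite !inE => /orP[/orP[]|] /eqP; [constructor 1|constructor 2|constructor 3].
have gE : (3 * (x + x') + m * (y + y') + n * (z + z') = g)%N by rewrite -uvE uE vE; lia.
(* Besides [g] itself, size rules out all but a multiple of [3], or one copy of the other of [m],
   [n] plus such a multiple; residues mod [3] exclude these. *)
have XYZ : (x + x' + (y + y') + (z + z') <= 1)%N.
  move: gS gE; move: (x + x')%N (y + y')%N (z + z')%N => X Y Z; clear - m3 n3 m_mod n_mod mn_mod mn nm.
  by case: Y => [|[|Y]]; case: Z => [|[|Z]]; case=> -> ; nia.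
have [/eqP|] := eqVneq (x + y + z)%N 0%N.
  rewrite !addn_eq0 => /andP[/andP[/eqP x0 /eqP y0] /eqP z0].
  by left; rewrite uE x0 y0 z0 !muln0.
move=> nz; right; have [x0 y0 z0] : [/\ x' = 0, y' = 0 & z' = 0]%N by split; lia.
by rewrite vE x0 y0 z0 !muln0.
Qed.

(** * The two sums and the generating set of the characteristic *)

Theorem theorem8 (p : nat) (p_pr : prime p) (p_ge7 : (7 <= p)%N)
    (G : {group {unit 'F_p}}) (cardG : #|G| = 3%N) :
  (exists a b : nat, norm_solution p a b) /\
  (exists m n : nat,
    [/\ m <> n,
        (forall s : nat,
          (exists a b : nat, norm_solution p a b /\ s = (a + b)%N) <->
          (s = m \/ s = n))
      & hgen_eq G [fset 3%N; m; n]%fset]).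
Proof.
have [w w3 Gw] := card3_cube_root p_pr cardG.
have p3 : (3 < p)%N by apply: leq_trans p_ge7.
have sol_ex := norm_solution_exists p_pr (ltnW p3) w3.
split=> //.
(* Equal entries would give [p = b^2]; otherwise the entries can be swapped. *)
have [a [b [sol ltba]]] : exists a b, norm_solution p a b /\ (b < a)%N.
  have [a [b sol]] := sol_ex; have [a0 b0 Nab] := sol.
  have [ltab|ltba|eqab] := ltngtP a b; last 1 first.
  - by case: (@prime_neq_sqr b p p_pr); move: Nab; rewrite eqab; clear; lia.
  - by exists b, a; split=> //; split=> //; rewrite -Nab; ring.
  - by exists a, b.
(* This solution provides the second sum, [2a - b]. *)
have sol2 : norm_solution p a (a - b).
  have [a0 b0 Nab] := sol; split=> //; first by rewrite subn_gt0.
  by rewrite -Nab -subzn ?(ltnW ltba) //; ring.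
have n2 : (a + (a - b) = 2 * a - b)%N by lia.
have m3 := norm_solution_sum_mod3 p_pr p3 sol.
have n3 := norm_solution_sum_mod3 p_pr p3 sol2; rewrite n2 in n3.
have [a0 b0 Nab] := sol.
have charE k : k \in hchar G <-> exists x y z, k = (3 * x + (a + b) * y + (2 * a - b) * z)%N.
  rewrite (mem_hchar w3 Gw); split=> [/(w_sum_norm p_pr w3)[i [j [l [-> dvd]]]]|].
    exact: dvd_norm_three_generators p_pr p3 ltba sol dvd.
  case=> x [y [z ->]]; rewrite -[X in w_sum _ _ X]addr0; apply: w_sumD.
    rewrite -[X in w_sum _ _ X]addr0; apply: w_sumD; apply: w_sumMn.
      (* The generator [3] comes from [1 + w + w^2 = 0]. *)
      by exists 1%N, 1%N, 1%N; split=> //; rewrite !mul1r -w3; ring.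
    exact: norm_solution_w_sum.
  by apply: w_sumMn; rewrite -n2; apply: norm_solution_w_sum.
exists (a + b)%N, (2 * a - b)%N; split.
(* Equal sums would give [a = 2b], and then [a + b = 3b]. *)
- by move: m3; clear; lia.
- move=> s; split=> [[c [d [sol' ->]]]|[]->].
  + exact: norm_solution_sum p_pr ltba sol sol'.
  + by exists a, b.
  + by exists a, (a - b)%N.
have u3 : uniq [:: 3; a + b; 2 * a - b]%N.
  rewrite /= !inE negb_or andbT; move: m3 n3; clear; lia.
apply: minimal_generating_set_irreducible; first exact: generates3.
move=> g gS; split.
- move: gS; rewrite !inE => /orP[/orP[]|] /eqP ->; apply/charE.
  + by exists 1%N, 0%N, 0%N; rewrite muln1 !muln0 !addn0.
  + by exists 0%N, 1%N, 0%N; rewrite muln1 !muln0 addn0.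
  + by exists 0%N, 0%N, 1%N; rewrite muln1 !muln0.
- by move: gS; rewrite !inE => /orP[/orP[]|] /eqP ->; move: ltba b0; clear; lia.
move=> u v; apply: (three_generators_irreducible _ _ m3 n3 _ _ _ charE gS);
  by move: ltba b0 m3 n3; clear; lia.
Qed.
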